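(* Let $n,\delta$ be positive integers with $\delta \le n-2$. If $G$ is a graph of order $n$ and minimum degree $\delta$, and $G$ is not isomorphic to $G_{n,\delta}$, then $$\eta(G) < \eta(G_{n,\delta}).$$
   Context: All graphs are finite and simple (undirected, no loops or multiple edges), and not assumed connected. The order of $G$ is $|V(G)|$. For a graph $G$, $\eta(G)$ denotes the number of connected induced subgraphs of $G$, i.e. the number of nonempty subsets $S\subseteq V(G)$ such that the subgraph of $G$ induced by $S$ is connected. The minimum degree of $G$ is the minimum of the degrees of its vertices. For positive integers $n,\delta$ with $n-2\ge\delta$, the graph $G_{n,\delta}$ is obtained by taking one copy of the complete graph $K_{n-1}$ and adding one further vertex that is adjacent to exactly $\delta$ vertices of $K_{n-1}$; it has order $n$ and minimum degree $\delta$. *)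

(* Defs.v *)
From mathcomp Require Import all_boot.

Set Implicit Arguments.
Unset Strict Implicit.
Unset Printing Implicit Defensive.

Record sgraph := SGraph {
  vertex :> finType;
  adj : rel vertex;
  adj_sym : symmetric adj;
  adj_irrefl : irreflexive adj }.

Definition order_graph (G : sgraph) : nat := #|G|.

Definition degree (G : sgraph) (x : G) : nat := #|[set y | adj x y]|.

(* Every degree is smaller than #|G|, so the starting value #|G| is only
   reached by the graph without vertices. *)
Definition min_degree (G : sgraph) : nat := \big[minn/#|G|]_(x : G) degree x.

Definition isomorphic (G H : sgraph) : Prop :=
  exists2 f : G -> H, bijective f & forall x y, adj (f x) (f y) = adj x y.

Section Induced.
Variables (G : sgraph) (S : {set G}).

Definition induced_adj : rel {x : G | x \in S} := [rel x y | adj (val x) (val y)].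

Lemma induced_adj_sym : symmetric induced_adj.
Proof. move=> x y; exact: adj_sym. Qed.

Lemma induced_adj_irrefl : irreflexive induced_adj.
Proof. move=> x; exact: adj_irrefl. Qed.

Definition induced : sgraph := SGraph induced_adj_sym induced_adj_irrefl.
End Induced.

(* Holds for the graph without vertices, which eta excludes separately. *)
Definition connected (G : sgraph) : bool :=
  [forall x : G, forall y : G, connect (@adj G) x y].

Definition eta (G : sgraph) : nat :=
  #|[set S : {set G} | (S != set0) && connected (induced S)]|.

Section Complete.
Variable m : nat.

Definition complete_adj : rel 'I_m := [rel x y | x != y].

Lemma complete_adj_sym : symmetric complete_adj.
Proof. by move=> x y; rewrite /complete_adj /= eq_sym. Qed.

Lemma complete_adj_irrefl : irreflexive complete_adj.
Proof. by move=> x; rewrite /complete_adj /= eqxx. Qed.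

Definition complete : sgraph := SGraph complete_adj_sym complete_adj_irrefl.
End Complete.

(* The graph G with one further vertex, None, adjacent to the vertices in A. *)
Section AddVertex.
Variables (G : sgraph) (A : {set G}).

Definition add_vertex_adj : rel (option G) := fun u v =>
  match u, v with
  | Some x, Some y => adj x y
  | Some x, None => x \in A
  | None, Some y => y \in A
  | None, None => false
  end.

Lemma add_vertex_adj_sym : symmetric add_vertex_adj.
Proof. by move=> [x|] [y|] //; exact: adj_sym. Qed.

Lemma add_vertex_adj_irrefl : irreflexive add_vertex_adj.
Proof. by move=> [x|] //; exact: adj_irrefl. Qed.

Definition add_vertex : sgraph := SGraph add_vertex_adj_sym add_vertex_adj_irrefl.
End AddVertex.

(* G_{n,d}: the choice of d neighbours in K_{n-1} is immaterial up to
   isomorphism; they are taken to be the first d vertices (d <= n - 1). *)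
Definition Gnd (n d : nat) : sgraph :=
  add_vertex [set i : complete n.-1 | (i : 'I_n.-1) < d].

(* Main.v *)
Require Import Defs.
From mathcomp Require Import all_boot.

(** Let [v] be a vertex of degree [d].  Numbering the neighbours of [v] first
and sending [v] to the extra vertex embeds [G] as a spanning subgraph of
[G_{n,d}], and connected sets stay connected when edges are added.  If [G] is
not isomorphic to [G_{n,d}], some edge [xy] of [G_{n,d}] is missing in [G], and
[{x, y}] is connected in [G_{n,d}] only. *)

Lemma connected_surj_hom {G H : sgraph} (g : G -> H) :
  (forall y, exists x, g x = y) -> (forall x y, adj x y -> adj (g x) (g y)) ->
  connected G -> connected H.
Proof.
move=> g_surj g_hom /forallP conG; apply/forallP => y1; apply/forallP => y2.
have [[x1 <-] [x2 <-]] := (g_surj y1, g_surj y2).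
have /connectP[p p_path ->] := forallP (conG x1) x2.
apply/connectP; exists (map g p); last by rewrite last_map.
exact: homo_path p_path.
Qed.

(** [f] restricts to an adjacency-preserving surjection from [S] onto [f @: S], whether or not it is
    injective. *)
Lemma connected_imset {G H : sgraph} (f : G -> H) (S : {set G}) :
  (forall x y, adj x y -> adj (f x) (f y)) ->
  connected (induced S) -> connected (induced (f @: S)).
Proof.
move=> f_hom; pose g (x : induced S) : induced (f @: S) :=
  exist (fun y => y \in f @: S) (f (val x)) (imset_f f (valP x)).
apply: (connected_surj_hom g) => [[y fSy]|x y]; last exact: f_hom.
have /imsetP[x Sx def_y] := fSy.
by exists (exist _ x Sx); apply: val_inj; rewrite /= def_y.
Qed.

Lemma connected_pair {G : sgraph} (x y : G) :
  x != y -> connected (induced [set x; y]) = adj x y.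
Proof.
move=> neq_xy; apply/idP/idP => [/forallP con_xy|adj_xy].
  pose u : induced [set x; y] := exist _ x (set21 x y).
  pose w : induced [set x; y] := exist _ y (set22 x y).
  (* As [x != y], the path has a first step [z]; it lies in the pair and is adjacent to [x], so it
     is [y]. *)
  have /connectP[[|z p] /= xyp eq_w] := forallP (con_xy u) w.
    by case/eqP: neq_xy; case: eq_w.
  have /andP[adj_uz _] := xyp; case: z adj_uz {xyp eq_w} => z /= xy_z.
  rewrite /induced_adj /=; case/set2P: xy_z => -> //.
  by rewrite adj_irrefl.
apply/forallP => -[a xy_a]; apply/forallP => -[b xy_b].
have [eq_ab | neq_ab] := eqVneq a b.
  by rewrite (_ : exist _ a xy_a = exist _ b xy_b) //; apply: val_inj.
apply: connect1; rewrite /= /induced_adj /=.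
case/set2P: xy_a neq_ab => ->; case/set2P: xy_b => ->; rewrite ?eqxx //.
by rewrite adj_sym.
Qed.

Lemma eta_spanning_subgraph_lt {G H : sgraph} (f : G -> H) :
  bijective f -> (forall x y, adj x y -> adj (f x) (f y)) ->
  ~ isomorphic G H -> eta G < eta H.
Proof.
move=> f_bij f_hom not_iso; have f_inj := bij_inj f_bij.
(* Without such a pair, [f] would also reflect adjacency and be an isomorphism. *)
have /existsP[x /existsP[y /andP[adj_fxy nadj_xy]]] :
    [exists x, exists y, adj (f x) (f y) && ~~ adj x y].
  apply: contra_notT not_iso => /existsPn no_xy; exists f => // x y.
  apply/idP/idP => [adj_fxy|]; last exact: f_hom.
  by have /existsPn/(_ y) := no_xy x; rewrite adj_fxy negbK.
have neq_xy : x != y by apply: contraTneq adj_fxy => ->; rewrite adj_irrefl.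
(* Taking images under [f] is injective on sets, so the count for [G] moves into [H], where proper
   inclusion suffices. *)
rewrite /eta -(card_imset _ (imset_inj f_inj)); apply/proper_card/properP.
split=> [|].
  apply/subsetP => _ /imsetP[S + ->]; rewrite !inE => /andP[S_n0 conS].
  by rewrite imset_eq0 S_n0 connected_imset.
exists (f @: [set x; y]).
  rewrite inE imset_eq0 -card_gt0 cards2 /= imsetU !imset_set1.
  by rewrite connected_pair // inj_eq.
rewrite (mem_imset _ _ (imset_inj f_inj)) inE connected_pair //.
by rewrite (negPf nadj_xy) andbF.
Qed.

(** An iterated minimum is either its starting value, here [#|G|], or one of its terms; the
    hypothesis rules out the former. *)
Lemma min_degree_attained {G : sgraph} :
  min_degree G < #|G| -> exists v : G, degree v = min_degree G.
Proof.
suff [->|//] : min_degree G = #|G| \/ exists v : G, degree v = min_degree G.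
  by rewrite ltnn.
rewrite /min_degree; elim/big_ind: _ => [|k l IHk IHl|v _]; first by left.
  by rewrite /minn; case: ifP.
by right; exists v.
Qed.

Lemma spanning_hom_Gnd {G : sgraph} (v : G) : exists2 f : G -> Gnd #|G| (degree v),
  bijective f & forall x y, adj x y -> adj (f x) (f y).
Proof.
pose N := [set y | adj v y].
pose s := enum N ++ enum (~: (v |: N)).
have v_notN : v \notin N by rewrite inE adj_irrefl.
have mem_s x : (x \in s) = (x != v).
  rewrite mem_cat !mem_enum in_setC in_setU1 negb_or.
  by have [->|] := eqVneq x v; [rewrite (negPf v_notN) | case: (x \in N)].
have size_s : size s = #|G|.-1.
  rewrite size_cat -!cardE -(cardsC (v |: N)) cardsU1 v_notN.
  by rewrite add1n addSn.
have idx_lt x : x != v -> index x s < #|G|.-1.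
  by rewrite -size_s index_mem mem_s.
(* Only [v] is absent from [s], so [insub] fails exactly there; every other vertex goes to its
   position in [s]. *)
pose f x : Gnd #|G| (degree v) :=
  if insub x : {? x | x != v} is Some u
  then Some (Ordinal (idx_lt (val u) (valP u))) else None.
have f_v : f v = None by rewrite /f insubF ?eqxx.
have f_nv x (nv : x != v) : f x = Some (Ordinal (idx_lt x nv)).
  by rewrite /f insubT; congr Some; apply: val_inj.
have f_inj : injective f.
  move=> x y; have [->|nx] := eqVneq x v; have [->|ny] := eqVneq y v => //.
  - by rewrite f_v f_nv.
  - by rewrite f_v f_nv.
  rewrite !f_nv => -[eq_xy].
  by rewrite -(nth_index v (_ : x \in s)) ?mem_s // eq_xy nth_index ?mem_s.
have G_gt0 : 0 < #|G| by apply/card_gt0P; exists v.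
exists f.
  by apply: inj_card_bij => //; rewrite card_option card_ord prednK.
have adj_fv y : adj v y -> adj (f v) (f y).
  move=> vy; have ny : y != v by apply: contraTneq vy => ->; rewrite adj_irrefl.
  have Ny : y \in enum N by rewrite mem_enum inE.
  (* Neighbours of [v] come first in [s], so their positions are below [degree v]. *)
  by rewrite f_v f_nv /= inE /= index_cat Ny /degree cardE index_mem.
move=> x y; have [->|nx] := eqVneq x v; first exact: adj_fv.
have [->|ny] := eqVneq y v; first by rewrite adj_sym [adj (f x) _]adj_sym; exact: adj_fv.
(* Away from [v] the target is complete, so only distinct images are needed. *)
move=> xy; rewrite (f_nv x nx) (f_nv y ny) /= /complete_adj /=.
apply: contraTneq xy => eq_xy; have -> : x = y.
  by apply: f_inj; rewrite (f_nv x nx) (f_nv y ny) eq_xy.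
by rewrite adj_irrefl.
Qed.

Theorem proposition2p1 (n d : nat) (n_gt0 : 0 < n) (d_gt0 : 0 < d)
    (le_d_n2 : d <= n - 2) (G : sgraph)
    (order_G : order_graph G = n) (min_degree_G : min_degree G = d)
    (not_iso : ~ isomorphic G (Gnd n d)) :
  eta G < eta (Gnd n d).
Proof.
have lt_dn : min_degree G < #|G|.
  rewrite min_degree_G -/(order_graph G) order_G.
  by rewrite (leq_ltn_trans le_d_n2) // ltn_subrL.
have [v deg_v] := min_degree_attained lt_dn.
have [f f_bij f_hom] := spanning_hom_Gnd v.
(* The type of [f] depends on [#|G|] and [degree v], so [f] is generalized before they become [n]
   and [d]. *)
move: f f_bij f_hom; rewrite deg_v min_degree_G -/(order_graph G) order_G.
by move=> f f_bij f_hom; apply: (eta_spanning_subgraph_lt f).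
Qed.
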